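(* Let $k\ge 2$ and let $u$ be an oriented word of rank $k$. The positive cone $P_u$ of the order on $F_k$ induced by $u$ is closed under word reversal if and only if $u=u^{-1}$ (equality of words).
   Context: Let $k\ge 2$ and let $\mathcal{A}=\{a_1,\dots,a_k\}$ be a basis of the free group $F_k$. For $a\in\mathcal{A}$ the inverse is denoted by the corresponding uppercase letter ($A=a^{-1}$, $B=b^{-1}$, $A_i=a_i^{-1}$). Letters in $\mathcal{A}$ are called positive (lowercase), letters in $\mathcal{A}^{-1}$ negative (uppercase), and $\mathcal{A}^{\pm}=\mathcal{A}\cup\mathcal{A}^{-1}$. Elements of $F_k$ are identified with reduced group words over $\mathcal{A}^\pm$; $e$ is the trivial element. An oriented word of rank $k$ is a word of length $2k$ over $\mathcal{A}^\pm$ containing each letter of $\mathcal{A}^\pm$ exactly once. For distinct $x,y\in\mathcal{A}^\pm$, ''$x..y$ in $u$'' means that $x$ is to the left of $y$ in $u$. $\#_w(g)$ is the number of (possibly overlapping) occurrences of $w$ as a contiguous subword of $g$. For an oriented word $u$ of rank $k$ and a reduced word $g$, define $$\alpha_u(g)=\sum_{a,b\in\mathcal{A},\ A..B\text{ in }u}\#_{aB}(g)-\sum_{a,b\in\mathcal{A},\ a..b\text{ in }u}\#_{Ba}(g),$$ $$\beta_u(g)=\sum_{a,b\in\mathcal{A},\ A..b\text{ in }u}\#_{ab}(g)-\sum_{a,b\in\mathcal{A},\ A..b\text{ in }u}\#_{BA}(g)$$ (sums over ordered pairs $(a,b)$; in $\beta_u$ the case $a=b$ is allowed), and let $\omega(g)=\frac12$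 if the last letter of $g$ is in $\mathcal{A}$, $\omega(g)=-\frac12$ if it is in $\mathcal{A}^{-1}$, $\omega(e)=0$. The weight induced by $u$ is $\tau_u=\alpha_u+\beta_u+\omega$ (always evaluated on reduced forms). The positive cone of the left order $\leq_u$ on $F_k$ induced by $u$ is $P_u=\{g\in F_k\mid\tau_u(g)>0\}$. For a group word $g=x_1x_2\cdots x_n$, $g^R=x_n\cdots x_2x_1$ is its reversal and $g^{-1}=x_n^{-1}\cdots x_1^{-1}$ its inverse word; $u^{-1}$ denotes the inverse word of $u$, without free reduction. $P_u$ is closed under word reversal if $g\in P_u$ implies $g^R\in P_u$. *)

(* Defs.v *)
From mathcomp Require Import all_boot all_order all_algebra.
Set Implicit Arguments.
Unset Strict Implicit.
Unset Printing Implicit Defensive.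
Import Order.TTheory GRing.Theory Num.Theory.
Local Open Scope ring_scope.

(* The basis of F_k is indexed by 'I_k: (i, true) is the basis element a_i and
   (i, false) is its inverse A_i. *)
Definition letter (k : nat) : Type := ('I_k * bool)%type.

Definition pos (k : nat) (i : 'I_k) : letter k := (i, true).
Definition neg (k : nat) (i : 'I_k) : letter k := (i, false).

Definition inv_letter (k : nat) (x : letter k) : letter k := (x.1, ~~ x.2).

(* Group words, not necessarily reduced. *)
Definition word (k : nat) : Type := seq (letter k).

(* The elements of F_k are the words w satisfying [reduced w]. *)
Definition reduced (k : nat) (w : word k) : bool :=
  sorted (fun x y => y != inv_letter x) w.

Definition inverse_word (k : nat) (w : word k) : word k :=
  rev (map (@inv_letter k) w).

Definition oriented_word (k : nat) (u : word k) : Prop :=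
  size u = (2 * k)%N /\ forall x : letter k, count_mem x u = 1%N.

(* "x..y in u". Every letter occurs exactly once in an oriented word, so [index]
   gives its position; the strict inequality forces x and y to be distinct. *)
Definition left_of (k : nat) (u : word k) (x y : letter k) : bool :=
  (index x u < index y u)%N.

(* #_w(g): the number of positions of g at which w starts. *)
Definition occ (k : nat) (w g : word k) : nat :=
  count (fun i => prefix w (drop i g)) (iota 0 (size g).+1).

Definition alpha (k : nat) (u g : word k) : rat :=
  \sum_(a : 'I_k) \sum_(b : 'I_k | left_of u (neg a) (neg b))
     (occ [:: pos a; neg b] g)%:R
  - \sum_(a : 'I_k) \sum_(b : 'I_k | left_of u (pos a) (pos b))
     (occ [:: neg b; pos a] g)%:R.

Definition beta (k : nat) (u g : word k) : rat :=
  \sum_(a : 'I_k) \sum_(b : 'I_k | left_of u (neg a) (pos b))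
     (occ [:: pos a; pos b] g)%:R
  - \sum_(a : 'I_k) \sum_(b : 'I_k | left_of u (neg a) (pos b))
     (occ [:: neg b; neg a] g)%:R.

Definition omega (k : nat) (g : word k) : rat :=
  if rev g is x :: _ then (if x.2 then 2%:R^-1 else - 2%:R^-1) else 0.

Definition tau (k : nat) (u g : word k) : rat :=
  alpha u g + beta u g + omega g.

(* P_u, as a subset of F_k, that is, of the set of reduced words. *)
Definition positive_cone (k : nat) (u : word k) : pred (word k) :=
  fun g => reduced g && (0 < tau u g).

Definition closed_under_reversal (k : nat) (P : pred (word k)) : Prop :=
  forall g : word k, P g -> P (rev g).

(* Main.v *)
Require Import Defs.
From mathcomp Require Import all_boot all_order all_algebra.
From mathcomp Require Import lra.

(** For a nonempty reduced word [g = x_1 ... x_n] the four families of two-letter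
    counts in [tau] are instances of a single rule. When [x_i] is positive, the
    factor [x_i x_(i+1)] has weight 1 exactly if [x_i^-1 .. x_(i+1)] in [u]; when
    [x_i] is negative it has weight -1 exactly if [x_(i+1) .. x_i^-1], that is
    (these letters being distinct, as [g] is reduced), weight
    [[x_i^-1 .. x_(i+1)] - 1]. With the contribution of the last letter this gives

      [tau_u(g) = 1/2 + turns_u(g) - negs(g)],

    where [turns] counts the [i] with [x_i^-1 .. x_(i+1)] in [u], and [negs]
    counts the negative letters ([tauE]). Hence [g] is positive if and only if
    [negs g <= turns u g] ([positive_coneE]).

    Reversal preserves [negs] and replaces the condition [x^-1 .. y] attached to
    each factor [x y] by [y^-1 .. x]. On the other hand [u = u^-1] says that
    inverting letters reverses their order in [u], i.e. that these two conditions
    are equivalent ([eq_inverse_wordP]). So if [u = u^-1] then [turns], and with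
    it [tau], is invariant under reversal.

    Conversely, let the cone be closed under reversal. Two-letter words with one
    positive and one negative letter have [negs = 1], so each is positive
    exactly when its only factor is counted by [turns]; this settles the pairs of
    letters of the same sign ([closed_mixed]). For [A..b] against [B..a] the words
    [ab] and [ba] are both positive and give no information; lengthening
    [ab] by [B] on the left or by [A] on the right brings the weight back
    to the threshold ([closed_positive_half]). *)

Set Implicit Arguments.
Unset Strict Implicit.
Unset Printing Implicit Defensive.
Import Order.TTheory GRing.Theory Num.Theory.
Local Open Scope ring_scope.

(** * Inversion of letters and reversal of words *)

Lemma inv_letterK k : involutive (@inv_letter k).
Proof. by case=> i b; rewrite /inv_letter /= negbK. Qed.

Lemma inv_letter_eq_sym k (x y : letter k) :
  (y == inv_letter x) = (x == inv_letter y).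
Proof. by rewrite eq_sym (can2_eq (@inv_letterK k) (@inv_letterK k)). Qed.

Lemma reduced_rev k (g : word k) : reduced (rev g) = reduced g.
Proof.
rewrite /reduced rev_sorted; apply: eq_sorted => x y.
by rewrite inv_letter_eq_sym.
Qed.

(** * The order of the letters of a word *)

Lemma left_of_trans k (u : word k) : transitive (left_of u).
Proof. by move=> y x z; apply: ltn_trans. Qed.

Lemma left_of_irr k (u : word k) : irreflexive (left_of u).
Proof. by move=> x; rewrite /left_of ltnn. Qed.

Lemma left_ofN k (u : word k) (x y : letter k) :
  x \in u -> x != y -> left_of u y x = ~~ left_of u x y.
Proof.
move=> xu xy; rewrite /left_of -leqNgt ltn_neqAle.
suff -> : index y u != index x u by [].
apply: contraNneq xy => exy; have yu : y \in u by rewrite -index_mem exy index_mem.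
by rewrite -(nth_index x xu) -(nth_index x yu) exy.
Qed.

(** Duplicate-free words are determined by their letters and by the order of these
    letters, because each is the sorted enumeration for its own [left_of]. *)
Lemma sorted_left_of k (u : word k) : uniq u -> sorted (left_of u) u.
Proof.
move=> uu; change (sorted (relpre (index^~ u) ltn) u); rewrite -sorted_map.
suff -> : map (index^~ u) u = iota 0 (size u) by apply: iota_ltn_sorted.
case: u uu => // x0 s uu; apply: (@eq_from_nth _ 0%N).
  by rewrite size_map size_iota.
move=> i; rewrite size_map => lti.
by rewrite (nth_map x0) // index_uniq // nth_iota.
Qed.

Lemma sorted_inverse_word k (r : rel (letter k)) (u : word k) :
  sorted r (inverse_word u) =
  sorted (fun x y => r (inv_letter y) (inv_letter x)) u.
Proof. by rewrite /inverse_word rev_sorted sorted_map. Qed.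

(** The order-theoretic form of [u = u^-1]: inversion of letters reverses [u]. *)
Definition flip_invariant k (u : word k) : Prop :=
  forall x y, left_of u x y -> left_of u (inv_letter y) (inv_letter x).

(** Under flip invariance both [u] and its inverse word are sorted for the strict
    order [left_of u], and a set has only one sorted enumeration. *)
Lemma eq_inverse_wordP k (u : word k) :
  uniq u -> (forall x, x \in u) ->
  u = inverse_word u <-> flip_invariant u.
Proof.
move=> uu full; split=> [eu x y xy | flip].
  have := sorted_left_of uu; rewrite {2}eu sorted_inverse_word => su.
  apply: (sorted_ltn_index _ su) xy => // b a c ab bc.
  exact: left_of_trans bc ab.
apply: (irr_sorted_eq (@left_of_trans k u) (@left_of_irr k u)).
- exact: sorted_left_of.
- rewrite sorted_inverse_word; apply: sub_sorted (sorted_left_of uu).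
  exact: flip.
- move=> x; rewrite full mem_rev -(inv_letterK x) mem_map ?full //.
  exact: can_inj (@inv_letterK k).
Qed.

(** * A closed formula for the weight *)

Lemma occ2_cons k (x y z t : letter k) (g : word k) :
  occ [:: x; y] [:: z, t & g] = ((x == z) && (y == t) + occ [:: x; y] (t :: g))%N.
Proof.
have iotaS : iota 0 (size [:: z, t & g]).+1
    = 0%N :: map (addn 1) (iota 0 (size (t :: g)).+1) by rewrite -iotaDl.
by rewrite /occ iotaS [LHS]/= count_map /= prefix0s andbT.
Qed.

Lemma occ2_seq1 k (x y z : letter k) : occ [:: x; y] [:: z] = 0%N.
Proof. by rewrite /occ /= andbF. Qed.

Definition negs k (g : word k) : nat := count (fun x => ~~ x.2) g.

(** The number of factors [y z] of [g] with [y^-1 .. z] in [u], whatever the signs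
    of [y] and [z]. *)
Definition turns k (u g : word k) : nat :=
  if g is x :: s then
    sumn (pairmap (fun y z => nat_of_bool (left_of u (inv_letter y) z)) x s)
  else 0%N.

(** Of all the two-letter words of a given sign pattern, only the one spelled by
    the first two letters of a word gains an occurrence from its head. *)
Lemma occ_sum_cons k (P : 'I_k -> 'I_k -> bool) (c d : bool)
    (x y : letter k) (g : word k) :
  \sum_(a : 'I_k) \sum_(b : 'I_k | P a b)
     ((occ [:: (a, c); (b, d)] [:: x, y & g])%:R : rat)
  = ([&& P x.1 y.1, x.2 == c & y.2 == d] : nat)%:R
    + \sum_(a : 'I_k) \sum_(b : 'I_k | P a b)
        (occ [:: (a, c); (b, d)] (y :: g))%:R.
Proof.
under eq_bigr => a _ do
  (under eq_bigr => b _ do rewrite occ2_cons natrD; rewrite big_split /=).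
rewrite big_split; congr (_ + _); case: x y => [i s] [j t] /=.
rewrite (bigD1 i) //= [X in _ + X]big1 ?addr0; last first.
  by move=> a /negPf ai; rewrite big1 // => b _; rewrite xpair_eqE ai.
rewrite big_mkcond (bigD1 j) //= [X in _ + X]big1 ?addr0; last first.
  by move=> b /negPf bj; rewrite !xpair_eqE bj andbF; case: ifP.
by rewrite !xpair_eqE !eqxx /= ![c == _]eq_sym ![d == _]eq_sym; case: (P i j).
Qed.

(** The sums for the words [Ba] in [alpha] and [BA] in [beta] bind their indices in
    the order opposite to that of the letters. *)
Lemma occ_sum_cons_swap k (P : 'I_k -> 'I_k -> bool) (c d : bool)
    (x y : letter k) (g : word k) :
  \sum_(a : 'I_k) \sum_(b : 'I_k | P a b)
     ((occ [:: (b, c); (a, d)] [:: x, y & g])%:R : rat)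
  = ([&& P y.1 x.1, x.2 == c & y.2 == d] : nat)%:R
    + \sum_(a : 'I_k) \sum_(b : 'I_k | P a b)
        (occ [:: (b, c); (a, d)] (y :: g))%:R.
Proof.
rewrite [LHS](exchange_big_dep predT) //= [in RHS](exchange_big_dep predT) //=.
exact: (occ_sum_cons (fun b a => P a b)).
Qed.

(** A factor [x y] with [x] negative contributes [- [y .. x^-1]], which is
    [[x^-1 .. y] - 1] since [y] and [x^-1] are distinct letters of [u]. *)
Lemma tau_cons2 k (u : word k) (x y : letter k) (g : word k) :
  (forall z, z \in u) -> y != inv_letter x ->
  tau u [:: x, y & g] =
  tau u (y :: g) + (left_of u (inv_letter x) y : nat)%:R - (~~ x.2 : nat)%:R.
Proof.
move=> full yx.
have omE : omega [:: x, y & g] = omega (y :: g).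
  by rewrite /omega !rev_cons; case: (rev g).
rewrite /tau {}omE /alpha /beta !occ_sum_cons !occ_sum_cons_swap.
have := left_ofN (full y) yx.
by case: x y {yx} => [i [|]] [j [|]]; rewrite /inv_letter /pos /neg /= ?andbF ?andbT;
  move=> ->; case: (left_of u _ _) => /=; lra.
Qed.

(** The 1/2 is what [omega] leaves once the last letter is also charged for its
    sign: [- 1/2 = 1/2 - 1]. *)
Lemma tauE k (u g : word k) :
  (forall z, z \in u) -> reduced g -> g != [::] ->
  tau u g = 2%:R^-1 + (turns u g)%:R - (negs g)%:R.
Proof.
move=> full; case: g => // x s rg _; elim: s x rg => [|y s IH] x.
  move=> _; rewrite /tau /alpha /beta /omega /=.
  rewrite !big1 => [|a _|a _|a _|a _];
    try by rewrite big1 // => b _; rewrite occ2_seq1.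
  by case: (x.2) => /=; lra.
rewrite /reduced /= => /andP[yx rs].
rewrite tau_cons2 // IH // /turns /negs /= !natrD; lra.
Qed.

(** The weight lies in [1/2 + Z], so its sign is decided by an integer comparison. *)
Lemma positive_coneE k (u g : word k) :
  (forall z, z \in u) ->
  positive_cone u g = [&& g != [::], reduced g & (negs g <= turns u g)%N].
Proof.
move=> full; rewrite /positive_cone; case: g => [|x s].
  by rewrite /tau /alpha /beta /omega /= !big1 ?ltxx // => a _; rewrite big1.
case rg: (reduced _) => //=; rewrite tauE //.
have [le|lt] := leqP (negs (x :: s)) (turns u (x :: s)).
  by move: le; rewrite -(ler_nat rat) => le; apply/idP; lra.
by move: lt; rewrite -(ler_nat rat) -natr1 => lt; apply/negP; lra.
Qed.

(** * Reversal and the positive cone *)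

Lemma turns_rcons k (u s : word k) (y x : letter k) :
  turns u (rcons (rcons s y) x) =
  (turns u (rcons s y) + left_of u (inv_letter y) x)%N.
Proof.
case: s => [|z s] //=; first by rewrite addn0.
rewrite -[in LHS]cats1 pairmap_cat sumn_cat last_rcons /=.
by rewrite addn0.
Qed.

Lemma negs_rev k (g : word k) : negs (rev g) = negs g.
Proof. exact: count_rev. Qed.

Lemma turns_rev k (u g : word k) :
  flip_invariant u -> turns u (rev g) = turns u g.
Proof.
move=> flip.
have flipE x y : left_of u (inv_letter x) y = left_of u (inv_letter y) x.
  by apply/idP/idP => /flip; rewrite inv_letterK.
case: g => // x s; elim: s x => // y s IH x.
rewrite !rev_cons turns_rcons -rev_cons IH /= addnC.
by rewrite flipE.
Qed.

Lemma flip_invariant_closed k (u : word k) :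
  (forall z, z \in u) -> flip_invariant u ->
  closed_under_reversal (positive_cone u).
Proof.
move=> full flip g; rewrite !positive_coneE // reduced_rev negs_rev turns_rev //.
by rewrite -!size_eq0 size_rev.
Qed.

(** With [a = pos i] and [b = pos j], the words [aB] and [Ba] are reversals of each
    other; the first is positive iff [A..B], the second iff [b..a]. *)
Lemma closed_mixed k (u : word k) (i j : 'I_k) :
  (forall z, z \in u) -> closed_under_reversal (positive_cone u) -> i != j ->
  left_of u (neg i) (neg j) = left_of u (pos j) (pos i).
Proof.
move=> full cl ij.
have nij : (j == i) = false by rewrite eq_sym (negPf ij).
have := cl [:: pos i; neg j]; have := cl [:: neg j; pos i].
rewrite !positive_coneE // /negs /turns /reduced /rev /inv_letter /pos /neg /=.
rewrite !xpair_eqE /= (negPf ij) nij /= !addn0.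
case: (left_of _ _ _); case: (left_of _ _ _) => //= h1 h2;
  first [by have := h1 isT | by have := h2 isT].
Qed.

(** Suppose [A..b] but not [B..a], where [a = pos i] and [b = pos j]. If [B..A], then
    [Bab] has one negative letter and a turn at [ab], so it is positive, while
    [baB] has no turn at [ba] (not [B..a]) nor at [aB] (not [A..B]). If [A..B], then
    [abA] is positive for the same reason, while [Aba] has no turn at [ba], nor at
    [Ab], because [a..b] would give [B..A] by [closed_mixed]. *)
Lemma closed_positive_half k (u : word k) (i j : 'I_k) :
  (forall z, z \in u) -> closed_under_reversal (positive_cone u) -> i != j ->
  left_of u (neg i) (pos j) -> left_of u (neg j) (pos i).
Proof.
move=> full cl ij AbT; apply/idPn => /negPf BaF.
have nij : (j == i) = false by rewrite eq_sym (negPf ij).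
have ABN : left_of u (neg j) (neg i) = ~~ left_of u (neg i) (neg j).
  by rewrite left_ofN // /neg xpair_eqE (negPf ij).
have AB := closed_mixed full cl ij.
have BA : left_of u (neg j) (neg i) = left_of u (pos i) (pos j).
  by apply: closed_mixed; rewrite // nij.
have := cl [:: neg j; pos i; pos j]; have := cl [:: pos i; pos j; neg i].
rewrite !positive_coneE // /negs /turns /reduced /rev.
move: AbT BaF ABN AB BA; rewrite /inv_letter /pos /neg /=.
move=> -> -> -> <- <-; rewrite !xpair_eqE /= (negPf ij) nij /= !addn0.
by case: (left_of _ _ _) => //= h1 h2;
  first [by have := h1 isT | by have := h2 isT].
Qed.

(** The case of a positive letter to the left of a negative one is the
    contrapositive of [closed_positive_half]. *)
Lemma closed_flip_invariant k (u : word k) :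
  (forall z, z \in u) -> closed_under_reversal (positive_cone u) ->
  flip_invariant u.
Proof.
move=> full cl [i s] [j t]; have [<-{j}|ij] := eqVneq i j.
  by case: s t => [] []; rewrite /inv_letter /= // left_of_irr.
have ji : j != i by rewrite eq_sym.
case: s t => [] []; rewrite /inv_letter /=.
- by rewrite -[left_of u (i, true) _](closed_mixed full cl ji).
- move=> aB; apply/idPn.
  rewrite -left_ofN ?xpair_eqE ?andbF // => /(closed_positive_half full cl ij).
  by apply/negP; rewrite -left_ofN ?xpair_eqE ?andbF.
- exact: closed_positive_half.
- by rewrite [left_of u (i, false) _](closed_mixed full cl ij).
Qed.

Theorem proposition19 (k : nat) (hk : (2 <= k)%N) (u : word k)
    (hu : oriented_word u) :
  closed_under_reversal (positive_cone u) <-> u = inverse_word u.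
Proof.
have [_ count1] := hu.
have full x : x \in u by rewrite -has_pred1 has_count count1.
have uu : uniq u by rewrite count_mem_uniq // => x; rewrite count1 full.
rewrite eq_inverse_wordP //; split.
  exact: closed_flip_invariant.
exact: flip_invariant_closed.
Qed.
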